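(* Let $n\ge 1$. In each of the following four cases, the matrix $g$ is invertible and is a reversing element for the matrix $A$, i.e. $gAg^{-1}=A^{-1}$: (1) $A=\mathrm{J}(\mu,n)$ with $\mu\in\{1,-1\}$, and $g=\Omega(\mu,n)$; (2) $A=\begin{pmatrix}\mathrm{J}(\lambda,n) & 0\\ 0 & \mathrm{J}(\lambda^{-1},n)\end{pmatrix}$ with $\lambda\in\mathbb{C}\setminus\{0\}$, $\mathrm{Im}(\lambda)\ge 0$, $|\lambda|\ne 1$, and $g=\begin{pmatrix}0 & \Omega(\lambda,n)\\ \Omega(\lambda,n)^{-1} & 0\end{pmatrix}$; (3) $A=\mathrm{J}(\alpha,n)$ with $\alpha\in\mathbb{C}$, $\mathrm{Im}(\alpha)>0$, $|\alpha|=1$, and $g=\Omega(\alpha,n)\,\mathbf{j}$; (4) $A=\begin{pmatrix}\mathrm{J}(\alpha,n) & 0\\ 0 & \mathrm{J}(\alpha,n)\end{pmatrix}$ with $\alpha\in\mathbb{C}$, $\mathrm{Im}(\alpha)>0$, $|\alpha|=1$, and $g=\begin{pmatrix}0 & \Omega(\alpha,n)\,\mathbf{j}\\ \big(\Omega(\alpha,n)\,\mathbf{j}\big)^{-1} & 0\end{pmatrix}$.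
   Context: All matrices are regarded as matrices over the real quaternions $\mathbb{H}=\mathbb{R}+\mathbb{R}\mathbf{i}+\mathbb{R}\mathbf{j}+\mathbb{R}\mathbf{k}$, with $\mathbb{C}=\mathbb{R}+\mathbb{R}\mathbf{i}$; for a matrix $P$, $P\,\mathbf{j}$ denotes the matrix obtained by multiplying every entry of $P$ on the right by $\mathbf{j}$. $\mathrm{J}(\lambda,m)$ is the $m\times m$ Jordan block with $\lambda$ on the diagonal, $1$ on the superdiagonal and $0$ elsewhere. For a non-zero $\lambda\in\mathbb{C}$, $\Omega(\lambda,n)=[x_{i,j}]_{n\times n}\in\mathrm{GL}(n,\mathbb{C})$ is the upper triangular matrix defined by: $x_{i,j}=0$ for $i>j$; $x_{i,n}=0$ for $1\le i\le n-1$; $x_{n,n}=1$; and, for $1\le i\le j\le n-1$, $x_{i,j}=-\lambda^{-1}x_{i+1,j}-\lambda^{-2}x_{i+1,j+1}$. *)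

(* Defs.v *)
From HB Require Import structures.
From mathcomp Require Import all_boot all_order all_algebra.
From mathcomp Require Import boolp classical_sets reals.
From mathcomp Require Export complex.
From mathcomp Require Import ring.
Set Implicit Arguments.
Unset Strict Implicit.
Unset Printing Implicit Defensive.
Import Order.TTheory GRing.Theory Num.Theory.
Local Open Scope ring_scope.
Local Open Scope complex_scope.

(* Quat a b c d stands for a + b i + c j + d k. *)
Record quat (R : Type) := Quat { qre : R; qim : R; qjm : R; qkm : R }.

Section QuatEncoding.
Variable R : Type.

Definition quat_enc (q : quat R) : R * R * R * R :=
  let: Quat a b c d := q in (a, b, c, d).

Definition quat_dec (t : R * R * R * R) : quat R :=
  let: (a, b, c, d) := t in Quat a b c d.

Lemma quat_encK : cancel quat_enc quat_dec.
Proof. by case. Qed.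

End QuatEncoding.

HB.instance Definition _ (R : eqType) :=
  Equality.copy (quat R) (can_type (@quat_encK R)).
HB.instance Definition _ (R : choiceType) :=
  Choice.copy (quat R) (can_type (@quat_encK R)).

Section QuatRing.
Variable R : comNzRingType.
Implicit Types p q r : quat R.

Definition addq p q : quat R :=
  let: Quat a b c d := p in let: Quat a' b' c' d' := q in
  Quat (a + a') (b + b') (c + c') (d + d').

Definition oppq p : quat R :=
  let: Quat a b c d := p in Quat (- a) (- b) (- c) (- d).

(* i^2 = j^2 = k^2 = -1, ij = k = -ji, jk = i = -kj, ki = j = -ik. *)
Definition mulq p q : quat R :=
  let: Quat a b c d := p in let: Quat a' b' c' d' := q in
  Quat (a * a' - b * b' - c * c' - d * d')
       (a * b' + b * a' + c * d' - d * c')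
       (a * c' - b * d' + c * a' + d * b')
       (a * d' + b * c' - c * b' + d * a').

Lemma addqA : associative addq.
Proof. by case=> [????] [????] [????]; rewrite /= !addrA. Qed.

Lemma addqC : commutative addq.
Proof. by case=> [a b c d] [????]; congr Quat; exact: addrC. Qed.

Lemma add0q : left_id (Quat 0 0 0 0) addq.
Proof. by case=> [????]; rewrite /= !add0r. Qed.

Lemma addNq : left_inverse (Quat 0 0 0 0) oppq addq.
Proof. by case=> [????]; rewrite /= !addNr. Qed.

HB.instance Definition _ := GRing.isZmodule.Build (quat R) addqA addqC add0q addNq.

Lemma mulqA : associative mulq.
Proof. by case=> [????] [????] [????]; congr Quat; ring. Qed.

Lemma mul1q : left_id (Quat 1 0 0 0) mulq.
Proof. by case=> [????]; congr Quat; ring. Qed.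

Lemma mulq1 : right_id (Quat 1 0 0 0) mulq.
Proof. by case=> [????]; congr Quat; ring. Qed.

Lemma mulqDl : left_distributive mulq addq.
Proof. by case=> [????] [????] [????]; congr Quat; ring. Qed.

Lemma mulqDr : right_distributive mulq addq.
Proof. by case=> [????] [????] [????]; congr Quat; ring. Qed.

Lemma oneq_neq0 : Quat 1 0 0 0 != 0 :> quat R.
Proof. by apply/eqP => -[/eqP]; rewrite oner_eq0. Qed.

HB.instance Definition _ := GRing.Zmodule_isNzRing.Build (quat R)
  mulqA mul1q mulq1 mulqDl mulqDr oneq_neq0.

End QuatRing.

Definition quat_of_complex (R : realType) (z : R[i]) : quat R :=
  let: a +i* b := z in Quat a b 0 0.

Definition quat_j (R : realType) : quat R := Quat 0 0 1 0.

Definition mxH (R : realType) m n (P : 'M[R[i]]_(m, n)) : 'M[quat R]_(m, n) :=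
  map_mx (@quat_of_complex R) P.

Definition mulmx_j (R : realType) m n (P : 'M[quat R]_(m, n)) :
    'M[quat R]_(m, n) :=
  map_mx (fun q => q * quat_j R) P.

(* The library's [unitmx] and [invmx] are based on the determinant and hence
   only available over commutative rings; over the quaternions we use two-sided
   inverses. As with [invmx], [mxinv A] is [A] when [A] is not invertible. *)
Section NonCommutativeInverse.
Variables (S : nzRingType) (n : nat).
Implicit Types A B g : 'M[S]_n.

Definition is_mxinv A B := A *m B = 1%:M /\ B *m A = 1%:M.

Definition mx_invertible A := exists B, is_mxinv A B.

Definition mxinv A : 'M[S]_n := xget A (is_mxinv A).

Lemma mxinvP A : mx_invertible A -> is_mxinv A (mxinv A).
Proof. exact: xgetPex. Qed.

Lemma mxinv_eq A B : is_mxinv A B -> mxinv A = B.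
Proof.
move=> AB; have [AC _] := mxinvP (ex_intro _ B AB).
by rewrite -[mxinv A]mul1mx -(proj2 AB) -mulmxA AC mulmx1.
Qed.

Definition reversing_element A g :=
  [/\ mx_invertible A, mx_invertible g & g *m A *m mxinv g = mxinv A].

End NonCommutativeInverse.

Definition Jordan (S : nzRingType) (lambda : S) (m : nat) : 'M[S]_m :=
  \matrix_(i, j) if i == j then lambda else (i.+1 == j :> nat)%:R.

(* Entries of Omega(lambda, n), with indices starting from 0. The recurrence
   goes from row i.+1 to row i, so the recursion is on the distance k of the row
   to the last one, i.e. the row index is i = n.-1 - k. *)
Fixpoint Omega_entry (F : fieldType) (lambda : F) (n k j : nat) : F :=
  if (j < n.-1 - k)%N then 0
  else if k is k'.+1 then
    if j == n.-1 then 0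
    else - lambda ^-1 * Omega_entry lambda n k' j
         - lambda ^- 2 * Omega_entry lambda n k' j.+1
  else 1.

Definition Omega (F : fieldType) (lambda : F) (n : nat) : 'M[F]_n :=
  \matrix_(i, j) Omega_entry lambda n (n.-1 - i) j.

Section OmegaEquations.
Variables (F : fieldType) (lambda : F) (n : nat).
Local Notation X := (Omega lambda n.+1).

Lemma Omega_lower (i j : 'I_n.+1) : (j < i)%N -> X i j = 0.
Proof.
move=> ji; rewrite mxE /=.
have lt_ji : (j < n - (n - i))%N by rewrite subKn // -ltnS.
by case: (n - i)%N lt_ji => [|k] /= ->.
Qed.

Lemma Omega_last_col (i : 'I_n.+1) : (i < n)%N -> X i ord_max = 0.
Proof.
move=> lt_in; rewrite mxE /=.
have := lt_in; rewrite -subn_gt0; case: (n - i)%N => // k _ /=.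
by rewrite eqxx; case: ifP.
Qed.

Lemma Omega_last : X ord_max ord_max = 1.
Proof. by rewrite mxE /= subnn /= subn0 ltnn. Qed.

Lemma Omega_rec (i j : 'I_n.+1) : (i <= j)%N -> (j < n)%N ->
  X i j = - lambda ^-1 * X (inord i.+1) j
          - lambda ^- 2 * X (inord i.+1) (inord j.+1).
Proof.
move=> le_ij lt_jn; have lt_in := leq_ltn_trans le_ij lt_jn.
rewrite !mxE !inordK //= -[in LHS](subnSK lt_in) /= subnSK //.
by rewrite subKn ?(ltnW lt_in) // ltnNge le_ij /= ltn_eqF.
Qed.

End OmegaEquations.

(* Main.v *)
(** With [N] the nilpotent shift, expanding [J(lambda) Omega J(1/lambda)] as
    [(lambda + N) Omega (1/lambda + N)] shows that the recurrence defining
    [Omega] says exactly [J(lambda) Omega J(1/lambda) = Omega]; and [Omega] is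
    triangular with non-zero diagonal.  If [A] and [g] are invertible, then
    [g A g^-1 = A^-1] amounts to [A g A = g].  Cases (1) and (2) follow; in
    cases (3) and (4), [j] moves past a complex matrix by conjugating it, and
    conjugation inverts [alpha] as [|alpha| = 1]. *)
Require Import Defs.
From HB Require Import structures.
From mathcomp Require Import all_boot all_order all_algebra reals complex.
From mathcomp Require Import ring.
Import Order.TTheory GRing.Theory Num.Theory.
Local Open Scope ring_scope.

Section Reversing.
Set Implicit Arguments.
Unset Strict Implicit.
Context {S : nzRingType}.

(** Multiplying [A *m g *m A = g] by [B] on the left and by [h] on the right leaves
    [g *m A *m h = B]. *)
Lemma reversing_elementP n (A B g h : 'M[S]_n) :
  is_mxinv A B -> is_mxinv g h -> A *m g *m A = g -> reversing_element A g.
Proof.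
move=> AB gh AgA; split; [by exists B | by exists h |].
rewrite (mxinv_eq AB) (mxinv_eq gh) -[LHS]mul1mx -(proj2 AB) -mulmxA.
by rewrite [A *m _]mulmxA [A *m _]mulmxA AgA (proj1 gh) mulmx1.
Qed.

(** The product to compute has off-diagonal blocks [A1 *m G *m A2] and [A2 *m H *m A1]. The first is
    [G] by hypothesis; inverting that equation makes the second [H]. *)
Lemma reversing_element_block n (A1 A2 B1 G H : 'M[S]_n) :
  is_mxinv A1 B1 -> is_mxinv G H -> A1 *m G *m A2 = G ->
  reversing_element (block_mx A1 0 0 A2) (block_mx 0 G H 0).
Proof.
move=> [AB BA] [GH HG] AGA.
(* Solving for [A2] shows it conjugate to the inverse of [A1], hence invertible. *)
have eA2 : A2 = H *m B1 *m G.
  by rewrite -[X in _ *m X]AGA -!mulmxA [B1 *m _]mulmxA BA mul1mx mulmxA HG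
             mul1mx.
have AHA : A2 *m H *m A1 = H.
  by rewrite eA2 -!mulmxA [G *m _]mulmxA GH mul1mx BA mulmx1.
have A2l : A2 *m (H *m A1 *m G) = 1%:M by rewrite !mulmxA AHA HG.
have A2r : H *m A1 *m G *m A2 = 1%:M by rewrite -!mulmxA [A1 *m _]mulmxA AGA.
apply: (@reversing_elementP _ _ (block_mx B1 0 0 (H *m A1 *m G)) _
          (block_mx 0 G H 0));
  rewrite /is_mxinv ?mulmx_block ?(mul0mx, mulmx0, addr0, add0r).
- by rewrite AB BA A2l A2r scalar_mx_block.
- by rewrite GH HG scalar_mx_block.
- by rewrite AGA AHA.
Qed.

End Reversing.

Section JordanOmega.
Set Implicit Arguments.
Unset Strict Implicit.
Variables (F : fieldType) (n : nat).
Implicit Types (lambda : F) (A : 'M[F]_n.+1).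

Let N : 'M[F]_n.+1 := \matrix_(i, j) (i.+1 == j :> nat)%:R.

Let mulNmx A i j : (N *m A) i j = if (i < n)%N then A (inord i.+1) j else 0.
Proof.
rewrite mxE; case: ltnP => [lt_in | le_ni].
  rewrite (bigD1 (inord i.+1)) //= mxE inordK // eqxx mul1r big1 ?addr0 // => k kNi.
  rewrite mxE; case: eqP => [ik | _]; last by rewrite mul0r.
  by case/eqP: kNi; apply: val_inj; rewrite /= inordK.
rewrite big1 // => k _; rewrite mxE.
by rewrite gtn_eqF ?mul0r // ltnS (leq_trans _ le_ni) // -ltnS.
Qed.

Let mulmxN A i j :
  (A *m N) i j = if (0 < j)%N then A i (inord j.-1) else 0.
Proof.
rewrite mxE; case: ltnP => [j0 | j0].
  have lt_j : (j.-1 < n.+1)%N by rewrite (leq_ltn_trans (leq_pred _)).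
  rewrite (bigD1 (inord j.-1)) //= mxE inordK // prednK // eqxx mulr1.
  rewrite big1 ?addr0 // => k kNj; rewrite mxE.
  case: eqP => [kj | _]; last by rewrite mulr0.
  by case/eqP: kNj; apply: val_inj; rewrite /= inordK // -kj.
rewrite big1 // => k _; rewrite mxE.
by rewrite gtn_eqF ?mulr0 // (leq_trans _ (ltn0Sn _)).
Qed.

Let JordanE lambda : Jordan lambda n.+1 = lambda%:M + N.
Proof.
apply/matrixP=> i j; rewrite !mxE; case: eqP => [->|_]; last by rewrite add0r.
by rewrite gtn_eqF // addr0.
Qed.

(** Besides the entry x_(i,j) of [Omega], the expansion contains lambda^-1 x_(i+1,j) + lambda
    x_(i,j-1) + x_(i+1,j-1), out-of-range terms being 0. This sum has to vanish. *)
Lemma Jordan_Omega_Jordan lambda : lambda != 0 ->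
  Jordan lambda n.+1 *m Omega lambda n.+1 *m Jordan lambda^-1 n.+1
  = Omega lambda n.+1.
Proof.
move=> l0; set X := Omega lambda n.+1.
rewrite !JordanE mulmxDl mul_scalar_mx mulmxDr !mulmxDl.
rewrite mul_mx_scalar -!scalemxAl scalerA mulVf // scale1r mul_mx_scalar.
have addE (A B : 'M[F]_n.+1) i j : (A + B) i j = A i j + B i j by rewrite mxE.
have scaleE a (A : 'M[F]_n.+1) i j : (a *: A) i j = a * A i j by rewrite mxE.
apply/matrixP=> i j; rewrite !addE !scaleE.
rewrite -[RHS]addr0 -addrA; congr (_ + _).
rewrite !mulmxN !mulNmx.
(* In the first column and in the last row, any surviving term lies below the diagonal. *)
have [j0|j0] := posnP j.
  case: ltnP => lt_in; last by rewrite !mulr0 !addr0.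
  by rewrite Omega_lower ?inordK ?j0 // !mulr0 !addr0.
have lt_j : (j.-1 < n)%N by rewrite prednK // -ltnS.
have lt_jS : (j.-1 < n.+1)%N by rewrite ltnW.
have [lt_in|le_ni] := ltnP i n; last first.
  by rewrite Omega_lower ?inordK // ?(leq_trans lt_j) // !mulr0 !addr0.
have [le_ij|lt_ji] := leqP i j.-1.
  (* The sum vanishes by [lambda] times the recurrence at row [i] and column [j.-1]. *)
  rewrite [X i _]Omega_rec ?inordK // prednK // inord_val -/X.
  by field.
rewrite !Omega_lower ?inordK // ?mulr0 ?addr0 //; first exact: leqW.
by rewrite -(prednK j0) ltnS.
Qed.

(** By triangularity the recurrence on the diagonal reduces to x_(i,i) = - lambda^-2 x_(i+1,i+1);
    the induction climbs from the corner entry 1. *)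
Lemma Omega_diag_neq0 lambda (i : 'I_n.+1) :
  lambda != 0 -> Omega lambda n.+1 i i != 0.
Proof.
move=> l0; have [k] := ubnP (n - i); elim: k i => // k IHk i lt_k.
have [lt_in|le_ni] := ltnP i n; last first.
  suff -> : i = ord_max by rewrite Omega_last oner_neq0.
  by apply: val_inj; apply/eqP; rewrite eqn_leq le_ni -ltnS ltn_ord.
have iS : (inord i.+1 : 'I_n.+1) = i.+1 :> nat by rewrite inordK.
rewrite Omega_rec // [X in _ * X - _]Omega_lower ?iS // mulr0 sub0r oppr_eq0.
rewrite mulf_neq0 ?invr_neq0 ?expf_neq0 //; apply: IHk.
by rewrite iS; move: lt_k; rewrite -(subnSK lt_in) ltnS.
Qed.

Lemma Omega_unit lambda : lambda != 0 -> Omega lambda n.+1 \in unitmx.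
Proof.
(* [det_trig] concerns lower triangular matrices, hence the transpose. *)
move=> l0; rewrite unitmxE -det_tr det_trig.
  by rewrite unitfE; apply/prodf_neq0 => i _; rewrite mxE Omega_diag_neq0.
by apply/is_trig_mxP => i j lt_ij; rewrite mxE Omega_lower.
Qed.

(** By [Jordan_Omega_Jordan] this matrix is a factor of the invertible [Omega]. *)
Lemma Jordan_unit lambda : lambda != 0 -> Jordan lambda n.+1 \in unitmx.
Proof.
move=> l0; have := Omega_unit l0; rewrite -{1}(Jordan_Omega_Jordan l0).
by rewrite !unitmx_mul => /andP[/andP[]].
Qed.

End JordanOmega.

Section ComplexInQuaternions.
Set Implicit Arguments.
Unset Strict Implicit.
Variable R : realType.
Local Notation C := R[i].

Lemma quat_of_complex_is_zmod_morphism :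
  zmod_morphism (@quat_of_complex R).
Proof. by case=> [a b] [c d]; congr Quat; rewrite ?subr0. Qed.

Lemma quat_of_complex_is_monoid_morphism :
  monoid_morphism (@quat_of_complex R).
Proof. by split=> // -[a b] [c d]; congr Quat; rewrite /=; ring. Qed.

HB.instance Definition _ := GRing.isZmodMorphism.Build C (quat R)
  (@quat_of_complex R) quat_of_complex_is_zmod_morphism.
HB.instance Definition _ := GRing.isMonoidMorphism.Build C (quat R)
  (@quat_of_complex R) quat_of_complex_is_monoid_morphism.

Lemma mxHM m n p (P : 'M[C]_(m, n)) (Q : 'M[C]_(n, p)) :
  mxH (P *m Q) = mxH P *m mxH Q.
Proof. exact: map_mxM. Qed.

Lemma mxH_inv n (P : 'M[C]_n) :
  P \in unitmx -> is_mxinv (mxH P) (mxH (invmx P)).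
Proof. by move=> uP; rewrite /is_mxinv -!mxHM mulmxV ?mulVmx // /mxH map_mx1. Qed.

Lemma quat_jM (z : C) :
  quat_j R * quat_of_complex z = quat_of_complex (conjc z) * quat_j R.
Proof. by case: z => a b; congr Quat; rewrite /=; ring. Qed.

Lemma quat_j_sqr : quat_j R * quat_j R = -1.
Proof. by congr Quat; rewrite /=; ring. Qed.

(** As a matrix product, multiplication by [j] is subject to associativity. *)
Lemma mulmx_jE m n (P : 'M[quat R]_(m, n)) : mulmx_j P = P *m (quat_j R)%:M.
Proof.
apply/matrixP=> i j; rewrite !mxE (bigD1 j) //= mxE eqxx mulr1n.
rewrite big1 ?addr0 // => k /negPf kj; by rewrite mxE kj mulr0.
Qed.

Lemma mul_j_mxH m n (P : 'M[C]_(m, n)) :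
  (quat_j R)%:M *m mxH P = mxH (map_mx conjc P) *m (quat_j R)%:M.
Proof.
by rewrite -mulmx_jE mul_scalar_mx; apply/matrixP=> i j; rewrite !mxE quat_jM.
Qed.

(** The inverse of [j] is [-j], and inverting a product reverses its factors. *)
Lemma mulmx_j_inv n (P Q : 'M[quat R]_n) :
  is_mxinv P Q -> is_mxinv (mulmx_j P) ((- quat_j R)%:M *m Q).
Proof.
have jj : (quat_j R)%:M *m (- quat_j R)%:M = 1%:M :> 'M_n.
  by rewrite -scalar_mxM mulrN quat_j_sqr opprK.
have jj' : (- quat_j R)%:M *m (quat_j R)%:M = 1%:M :> 'M_n.
  by rewrite -scalar_mxM mulNr quat_j_sqr opprK.
move=> [PQ QP]; rewrite mulmx_jE; split.
  by rewrite -mulmxA [_%:M *m (_ *m _)]mulmxA jj mul1mx.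
by rewrite -mulmxA [Q *m _]mulmxA QP mul1mx.
Qed.

Lemma map_conjc_Jordan (alpha : C) n : `|alpha| = 1 ->
  map_mx conjc (Jordan alpha n) = Jordan alpha^-1 n.
Proof.
move=> a1; apply/matrixP=> i j; rewrite !mxE; case: ifP => _.
  by rewrite [RHS]invC_norm a1 expr1n invr1 mul1r.
exact: (rmorph_nat conjc).
Qed.

(** Moving [j] to the far right turns the second Jordan block into that of alpha^-1, which is the
    complex identity. *)
Lemma Jordan_Omegaj_Jordan (alpha : C) n : `|alpha| = 1 ->
  mxH (Jordan alpha n.+1) *m mulmx_j (mxH (Omega alpha n.+1))
    *m mxH (Jordan alpha n.+1) = mulmx_j (mxH (Omega alpha n.+1)).
Proof.
move=> a1; have a0 : alpha != 0 by rewrite -normr_eq0 a1 oner_neq0.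
rewrite mulmx_jE -!mulmxA mul_j_mxH map_conjc_Jordan // !mulmxA -!mxHM.
by rewrite Jordan_Omega_Jordan.
Qed.

End ComplexInQuaternions.

Theorem mainTheorem4 (R : realType) (n : nat) (hn : (1 <= n)%N) :
  [/\ forall mu : R[i], mu = 1 \/ mu = -1 ->
        reversing_element (mxH (Jordan mu n)) (mxH (Omega mu n)),
      forall lambda : R[i],
        lambda != 0 -> 0 <= complex.Im lambda -> `|lambda| != 1 ->
        reversing_element
          (block_mx (mxH (Jordan lambda n)) 0 0 (mxH (Jordan lambda^-1 n)))
          (block_mx 0 (mxH (Omega lambda n)) (mxH (invmx (Omega lambda n))) 0),
      forall alpha : R[i], 0 < complex.Im alpha -> `|alpha| = 1 ->
        reversing_element (mxH (Jordan alpha n)) (mulmx_j (mxH (Omega alpha n)))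
    & forall alpha : R[i], 0 < complex.Im alpha -> `|alpha| = 1 ->
        reversing_element
          (block_mx (mxH (Jordan alpha n)) 0 0 (mxH (Jordan alpha n)))
          (block_mx 0 (mulmx_j (mxH (Omega alpha n)))
                    (mxinv (mulmx_j (mxH (Omega alpha n)))) 0)].
Proof.
case: n hn => // n _; split=> [mu hmu | lambda l0 _ _ | alpha _ a1 | alpha _ a1].
- have m0 : mu != 0 by case: hmu => ->; rewrite ?oppr_eq0 oner_neq0.
  apply: reversing_elementP (mxH_inv (Jordan_unit n m0))
    (mxH_inv (Omega_unit n m0)) _.
  (* As [mu] is its own inverse, both Jordan blocks of the identity coincide. *)
  have muV : mu^-1 = mu by case: hmu => ->; rewrite ?invrN invr1.
  by rewrite -!mxHM -[X in _ *m Jordan X _]muV Jordan_Omega_Jordan.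
- apply: reversing_element_block (mxH_inv (Jordan_unit n l0))
    (mxH_inv (Omega_unit n l0)) _.
  by rewrite -!mxHM Jordan_Omega_Jordan.
- have a0 : alpha != 0 by rewrite -normr_eq0 a1 oner_neq0.
  exact: reversing_elementP (mxH_inv (Jordan_unit n a0))
    (mulmx_j_inv (mxH_inv (Omega_unit n a0))) (Jordan_Omegaj_Jordan n a1).
- have a0 : alpha != 0 by rewrite -normr_eq0 a1 oner_neq0.
  have gh := mulmx_j_inv (mxH_inv (Omega_unit n a0)).
  apply: reversing_element_block (mxH_inv (Jordan_unit n a0)) _
    (Jordan_Omegaj_Jordan n a1).
  (* The block is [mxinv] itself; the explicit inverse only witnesses invertibility. *)
  exact: mxinvP (ex_intro _ _ gh).
Qed.
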